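(* Let $K$ be an algebraically closed field of characteristic zero and let $A=KQ/I$ be a bound quiver algebra over $K$. If $A$ is Schur-representation-finite, then $A$ has the multiplicity-free property (is MF). In particular, if $A$ has the dense orbit property (is DO), then $A$ also has the multiplicity-free property.
   Context: A bound quiver algebra is a finite-dimensional algebra $A=KQ/I$, where $Q$ is a finite quiver with vertex set $Q_0$ and arrow set $Q_1$ and $I$ is an admissible ideal of the path algebra $KQ$. All modules are finite-dimensional left modules, identified with representations of $Q$ satisfying the relations in $I$. An $A$-module $M$ is Schur if $\mathrm{End}_A(M)\simeq K$. $A$ is Schur-representation-finite if, for each dimension vector $\mathbf{d}$ of $A$, there are finitely many $\mathbf{d}$-dimensional Schur $A$-modules up to isomorphism. A dimension vector is a function $\mathbf{d}\colon Q_0\to\mathbb{N}$ (non-negative integers). Writing $ta$, $ha$ for the tail and head of an arrow $a$, the module variety is $$\mathrm{mod}(A,\mathbf{d})=\Big\{M\in\prod_{a\in Q_1}\mathrm{Mat}_{\mathbf{d}(ha)\times\mathbf{d}(ta)}(K)\ \Big|\ M(r)=0\ \text{for all } r\in I\Big\}$$ (set of $K$-points, with reduced structure), on which $\mathrm{GL}(\mathbf{d})=\prod_{i\in Q_0}\mathrm{GL}(\mathbf{d}(i),K)$ acts by base change, $(g\cdot M)(a)=g(ha)M(a)g(ta)^{-1}$. $A$ is DO if, for every $\mathbf{d}$, each irreducible component of $\mathrm{mod}(A,\mathbf{d})$ contains a dense $\mathrm{GL}(\mathbf{d})$-orbit. For $\theta\in\mathbb{Z}^{Q_0}$ let $\chi_\theta(g)=\prod_{i\in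 Q_0}\det g(i)^{\theta(i)}$ for $g\in\mathrm{GL}(\mathbf{d})$. For an irreducible component $C\subseteq\mathrm{mod}(A,\mathbf{d})$, let $\mathrm{SI}(C)_\theta=\{f\in K[C]\mid g f=\chi_\theta(g)f\text{ for all }g\in\mathrm{GL}(\mathbf{d})\}$. $A$ is MF if $\dim_K\mathrm{SI}(C)_\theta\le 1$ for all $\mathbf{d}$, all irreducible components $C$ of $\mathrm{mod}(A,\mathbf{d})$ and all $\theta\in\mathbb{Z}^{Q_0}$. *)

(* Defs.v *)
From HB Require Import structures.
From mathcomp Require Import all_boot all_order all_algebra.
From mathcomp Require Import freeg mpoly.

Set Implicit Arguments.
Unset Strict Implicit.
Unset Printing Implicit Defensive.

Import GRing.Theory.
Local Open Scope ring_scope.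

Record quiver := Quiver {
  vertex : finType;
  arrow : finType;
  tl : arrow -> vertex;
  hd : arrow -> vertex
}.

(* [qpath i j] is the type of paths from i to j.  As for left modules, the
   last arrow travelled is written first: [PCons a p] is the path a p. *)
Inductive qpath (Q : quiver) (i : vertex Q) : vertex Q -> Type :=
| PNil : qpath i i
| PCons (a : arrow Q) (p : qpath i (tl a)) : qpath i (hd a).

Arguments PNil {Q} i.
Arguments PCons {Q i} a p.

Fixpoint plen (Q : quiver) (i j : vertex Q) (p : qpath i j) : nat :=
  match p with PNil => 0 | PCons _ p' => (plen p').+1 end.

Fixpoint path_comp (Q : quiver) (i j k : vertex Q) (p : qpath j k) :
    qpath i j -> qpath i k :=
  match p in qpath _ k0 return qpath i j -> qpath i k0 with
  | PNil => id
  | PCons a p' => fun q => PCons a (path_comp p' q)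
  end.

Section PathChoice.
Variables (Q : quiver) (i : vertex Q).

Fixpoint parrows j (p : qpath i j) : seq (arrow Q) :=
  match p with PNil => [::] | PCons a p' => a :: parrows p' end.

Definition pcast j k (p : qpath i j) : option (qpath i k) :=
  match j =P k with
  | ReflectT e => Some (eq_rect j (qpath i) p k e)
  | ReflectF _ => None
  end.

Fixpoint pread (s : seq (arrow Q)) : option {j : vertex Q & qpath i j} :=
  match s with
  | [::] => Some (existT _ i (PNil i))
  | a :: s' =>
      obind (fun u => omap (fun p => existT _ (hd a) (PCons a p))
                           (pcast (tl a) (projT2 u)))
            (pread s')
  end.

Lemma pcast_id j (p : qpath i j) : pcast j p = Some p.
Proof. by rewrite /pcast; case: eqP => // e; rewrite (eq_axiomK e). Qed.

Lemma preadK j (p : qpath i j) : pread (parrows p) = Some (existT _ j p).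
Proof. by elim: p => [|a p IHp] //=; rewrite IHp /= pcast_id. Qed.

Lemma parrowsK j :
  pcancel (@parrows j) (fun s => obind (fun u => pcast j (projT2 u)) (pread s)).
Proof. by move=> p; rewrite preadK /= pcast_id. Qed.

End PathChoice.

HB.instance Definition _ (Q : quiver) (i j : vertex Q) :=
  Choice.copy (qpath i j) (pcan_type (@parrowsK Q i j)).

(* The path algebra KQ through its decomposition as the direct sum of the
   spaces e_j KQ e_i: the component at (i, j) is the vector space with basis
   the paths from i to j. *)
Definition path_alg (K : fieldType) (Q : quiver) :=
  forall i j : vertex Q, {freeg (qpath i j) / K}.

Section PathAlgebra.
Variables (K : fieldType) (Q : quiver).
Implicit Types (x y : path_alg K Q) (I : path_alg K Q -> Prop).

Definition pa_zero : path_alg K Q := fun _ _ => 0.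

Definition pa_add x y : path_alg K Q := fun i j => x i j + y i j.

Definition pa_mul x y : path_alg K Q := fun i k =>
  \sum_(j : vertex Q)
    fglift (fun p : qpath j k =>
      fglift (fun q : qpath i j => << path_comp p q >>) (y i j)) (x j k).

(* Closure under K-scalars is the case of multiplication by c * 1, where 1 is
   the (finite) sum of the trivial paths. *)
Definition two_sided_ideal I : Prop :=
  [/\ I pa_zero,
      forall x y, I x -> I y -> I (pa_add x y),
      forall x y, I y -> I (pa_mul x y)
    & forall x y, I x -> I (pa_mul x y)].

(* The power R^l of the arrow ideal R, i.e. the span of paths of length
   at least l. *)
Definition arrow_ideal_pow (l : nat) x : Prop :=
  forall (i j : vertex Q) (p : qpath i j), p \in dom (x i j) -> (l <= plen p)%N.

Definition admissible I : Prop :=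
  [/\ two_sided_ideal I,
      forall x, I x -> arrow_ideal_pow 2 x
    & exists2 m, (2 <= m)%N & forall x, arrow_ideal_pow m x -> I x].

End PathAlgebra.

Definition rep (K : fieldType) (Q : quiver) (d : vertex Q -> nat) :=
  forall a : arrow Q, 'M[K]_(d (hd a), d (tl a)).

Section Representations.
Variables (K : fieldType) (Q : quiver) (d : vertex Q -> nat).
Implicit Types (M N : rep K d) (Z C D : rep K d -> Prop).
Implicit Types (I : path_alg K Q -> Prop) (g phi : forall i, 'M[K]_(d i)).

Fixpoint rep_path M (i j : vertex Q) (p : qpath i j) : 'M[K]_(d j, d i) :=
  match p in qpath _ j0 return 'M[K]_(d j0, d i) with
  | PNil => 1%:M
  | PCons a p' => M a *m rep_path M p'
  end.

(* The component from M(i) to M(j) of the operator M(x). *)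
Definition rep_eval M (x : path_alg K Q) (i j : vertex Q) : 'M[K]_(d j, d i) :=
  fglift (@rep_path M i j) (x i j).

Definition mod_variety I M : Prop :=
  forall x, I x -> forall i j, rep_eval M x i j = 0.

Definition rep_endo M phi : Prop :=
  forall a : arrow Q, phi (hd a) *m M a = M a *m phi (tl a).

(* End(M) is isomorphic to K: there is a K-algebra isomorphism e from K onto
   the algebra of endomorphisms. *)
Definition schur M : Prop :=
  exists e : K -> forall i, 'M[K]_(d i),
    [/\ (forall c, rep_endo M (e c)),
        (forall phi, rep_endo M phi -> exists c, forall i, phi i = e c i),
        (forall b c, (forall i, e b i = e c i) -> b = c)
      & [/\ forall i, e 1 i = 1%:M,
            forall b c i, e (b + c) i = e b i + e c i,
            forall b c i, e (b * c) i = e b i *m e c i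
          & forall b c i, e (b * c) i = b *: e c i]].

Definition in_GL g : Prop := forall i, g i \in unitmx.

Definition GL_inv g : forall i, 'M[K]_(d i) := fun i => invmx (g i).

Definition GL_act g M : rep K d :=
  fun a => g (hd a) *m M a *m invmx (g (tl a)).

Definition rep_iso M N : Prop :=
  exists2 g, in_GL g & forall a, g (hd a) *m M a = N a *m g (tl a).

(* Matrix entries are the coordinates of the affine space of all
   representations. *)
Definition coord : finType := {a : arrow Q & ('I_(d (hd a)) * 'I_(d (tl a)))%type}.

Definition rep_coord M (k : 'I_#|coord|) : K :=
  let u := enum_val k in M (tag u) (tagged u).1 (tagged u).2.

Definition rep_poly := {mpoly K[#|coord|]}.

Definition poly_eval (f : rep_poly) M : K := f.@[rep_coord M].

Definition zariski_closed Z : Prop :=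
  exists S : rep_poly -> Prop, forall M, Z M <-> (forall f, S f -> poly_eval f M = 0).

Definition irreducible C : Prop :=
  (exists M, C M) /\
  (forall Z1 Z2, zariski_closed Z1 -> zariski_closed Z2 ->
     (forall M, C M -> Z1 M \/ Z2 M) ->
     (forall M, C M -> Z1 M) \/ (forall M, C M -> Z2 M)).

Definition irreducible_component I C : Prop :=
  [/\ zariski_closed C, irreducible C, (forall M, C M -> mod_variety I M)
    & forall D, zariski_closed D -> irreducible D ->
        (forall M, D M -> mod_variety I M) ->
        (forall M, C M -> D M) -> forall M, D M -> C M].

Definition has_dense_orbit C : Prop :=
  exists M, (forall g, in_GL g -> C (GL_act g M)) /\
    (forall Z, zariski_closed Z -> (forall g, in_GL g -> Z (GL_act g M)) ->
       forall N, C N -> Z N).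

Definition chi (theta : vertex Q -> int) g : K :=
  \prod_i (\det (g i)) ^ (theta i).

(* Elements of K[C] are represented by polynomials on the space of all
   representations; two of them are equal in K[C] when they agree on C (C is
   taken with its reduced structure).  GL acts by (g f)(M) = f(g^-1 M). *)
Definition semi_invariant C theta (f : rep_poly) : Prop :=
  forall g, in_GL g -> forall M, C M ->
    poly_eval f (GL_act (GL_inv g) M) = chi theta g * poly_eval f M.

(* The image in K[C] of the space V of polynomials has dimension at most n:
   any n + 1 of its elements are linearly dependent in K[C]. *)
Definition dim_le C (V : rep_poly -> Prop) (n : nat) : Prop :=
  forall f : 'I_n.+1 -> rep_poly, (forall k, V (f k)) ->
    exists2 c : 'I_n.+1 -> K, (exists k, c k != 0) &
      forall M, C M -> poly_eval (\sum_k c k *: f k) M = 0.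

End Representations.

(* In the following, I is the ideal of relations of the algebra A = KQ/I. *)
Section Properties.
Variables (K : fieldType) (Q : quiver) (I : path_alg K Q -> Prop).

Definition schur_rep_finite : Prop :=
  forall d : vertex Q -> nat, exists n (S : 'I_n -> rep K d),
    forall M : rep K d, mod_variety I M -> schur M -> exists k, rep_iso M (S k).

Definition dense_orbit_property : Prop :=
  forall (d : vertex Q -> nat) (C : rep K d -> Prop),
    irreducible_component I C -> has_dense_orbit C.

Definition multiplicity_free : Prop :=
  forall (d : vertex Q -> nat) (C : rep K d -> Prop),
    irreducible_component I C ->
    forall theta : vertex Q -> int, dim_le C (semi_invariant C theta) 1.

End Properties.

(* Main.v *)
(* Let f and g be semi-invariants of the same weight on a component C, linearly
   independent on C.  The value of f / g at a point M of C with g(M) <> 0 does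
   not change along GL-orbits, nor under the one-parameter degeneration of M to
   N + M/N when the subrepresentation N has weight zero.  As M is semistable,
   kernels and images of endomorphisms of direct summands of M have weight zero,
   so such degenerations lead to a direct sum of representations all of whose
   nonzero endomorphisms are injective, hence of Schur representations.  When
   there are finitely many of these, f / g takes finitely many values on the
   irreducible C and is constant.  If C has a dense orbit, f / g is constant at
   once. *)
From HB Require Import structures.
Require Import Defs.
From mathcomp Require Import all_boot all_order all_algebra.
From mathcomp Require Import freeg mpoly.
From Stdlib Require Import Classical.

Set Implicit Arguments.
Unset Strict Implicit.
Unset Printing Implicit Defensive.

Import Order.TTheory GRing.Theory Num.Theory.
Local Open Scope ring_scope.

(** * Idempotent matrices, and polynomials in characteristic zero *)

Section LinearAlgebra.
Variable K : fieldType.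

(** Two block triangular factorizations of one matrix are compared. *)
Lemma det_1D_mulC m n (A : 'M[K]_(m, n)) (B : 'M[K]_(n, m)) :
  \det (1%:M + A *m B) = \det (1%:M + B *m A).
Proof.
have lE : block_mx 1%:M (- A) B 1%:M =
    block_mx 1%:M 0 B 1%:M *m block_mx 1%:M (- A) 0 (1%:M + B *m A).
  by rewrite mulmx_block !(mul1mx, mulmx1, mul0mx, mulmx0, addr0)
    mulmxN addrCA addNr addr0.
have rE : block_mx 1%:M (- A) B 1%:M =
    block_mx (1%:M + A *m B) (- A) 0 1%:M *m block_mx 1%:M 0 B 1%:M.
  by rewrite mulmx_block !(mulmx1, mul1mx, mulmx0, mul0mx, add0r)
    mulNmx addrK.
have := congr1 determinant lE; rewrite rE !det_mulmx !(det_ublock, det_lblock).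
by rewrite !det1 !mul1r !mulr1.
Qed.

(** In the full-rank factorization of [e] the outer factors of [e *m e = e] cancel, so [e] splits
    through a space of dimension [\rank e]. *)
Lemma idempotent_split n (e : 'M[K]_n) : e *m e = e ->
  row_base e *m col_base e = 1%:M.
Proof.
move=> ee; apply: (row_full_inj (col_base_full e)).
apply: (row_free_inj (row_base_free e)).
by rewrite mulmx1 mulmx_base mulmxA mulmx_base -mulmxA mulmx_base ee.
Qed.

Lemma mxtrace_idempotent n (e : 'M[K]_n) : e *m e = e ->
  \tr e = (\rank e)%:R.
Proof.
by move=> ee; rewrite -{1}(mulmx_base e) mxtrace_mulC idempotent_split // mxtrace1.
Qed.

Lemma det_idempotent_scale n (e : 'M[K]_n) t : e *m e = e ->
  \det (1%:M - e + t *: e) = t ^+ \rank e.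
Proof.
move=> ee; rewrite -addrA -{1 2}[e]mulmx_base -scaleN1r -scalerDl scalemxAl.
rewrite det_1D_mulC -scalemxAr idempotent_split // -{1}[1%:M]scale1r -scalerDl.
by rewrite addrA subrr add0r detZ det1 mulr1.
Qed.

Hypothesis char0 : [pchar K] =i pred0.

Lemma natr_inj_char0 : injective (fun n => n%:R : K).
Proof.
have /pcharf0P natr0 := char0.
move=> m n /= mn; wlog le_mn : m n mn / (m <= n)%N.
  by case/orP: (leq_total m n) => le_mn H; [apply: H | symmetry; apply: H].
by apply/eqP; rewrite eqn_leq le_mn -subn_eq0 -natr0 natrB // mn subrr eqxx.
Qed.

(** The rank of an idempotent is its trace, which is additive; characteristic zero lets ranks be
    compared inside [K]. *)
Lemma mxrank_add_idempotent n (e f : 'M[K]_n) :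
    e *m e = e -> f *m f = f -> e *m f = 0 -> f *m e = 0 ->
  \rank (e + f)%R = (\rank e + \rank f)%N.
Proof.
move=> ee ff ef fe.
have ss : (e + f) *m (e + f) = e + f.
  by rewrite mulmxDl !mulmxDr ee ff ef fe addr0 add0r.
apply: natr_inj_char0; rewrite /= natrD -(mxtrace_idempotent ss) mxtraceD.
by rewrite !mxtrace_idempotent.
Qed.

(** The integers from 1 to [size p] are distinct and nonzero in [K], more roots than a nonzero [p]
    can have. *)
Lemma poly_eq0_punctured (p : {poly K}) :
  (forall t, t != 0 -> p.[t] = 0) -> p = 0.
Proof.
move=> p0; apply/eqP; apply: contraT => pN0.
have /pcharf0P natr0 := char0.
have := max_poly_roots (rs := [seq n%:R | n <- iota 1 (size p)]) pN0.
rewrite size_map size_iota ltnn; apply.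
  apply/allP=> _ /mapP[n n_in ->]; apply/rootP/p0; rewrite natr0.
  by move: n_in; rewrite mem_iota lt0n => /andP[].
by rewrite map_inj_uniq ?iota_uniq //; apply: natr_inj_char0.
Qed.

Lemma poly_nonroot (p : {poly K}) : p != 0 -> exists t, p.[t] != 0.
Proof.
move=> pN0; apply: NNPP => noroot; case/eqP: pN0; apply: poly_eq0_punctured => t _.
by apply/eqP; apply: contraT => pt; case: noroot; exists t.
Qed.

End LinearAlgebra.

(** * Algebras of functions, and rational functions of one variable *)

Section FunctionAlgebras.
Variable K : fieldType.

(** These closure properties suffice for determinants, adjugates and polynomial evaluation. The
    instances are the rational functions of a parameter and the polynomial functions on the
    representation space. *)
Record funalg (T : Type) (A : (T -> K) -> Prop) : Prop := FunAlg {
  funalg_ext : forall x y, x =1 y -> A x -> A y;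
  funalgC : forall c, A (fun=> c);
  funalgD : forall x y, A x -> A y -> A (fun t => x t + y t);
  funalgM : forall x y, A x -> A y -> A (fun t => x t * y t)
}.

Section Closure.
Variables (T : Type) (A : (T -> K) -> Prop).
Hypothesis algA : funalg A.

Lemma funalg_sum (J : Type) (r : seq J) (P : pred J) (F : J -> T -> K) :
  (forall j, P j -> A (F j)) -> A (fun t => \sum_(j <- r | P j) F j t).
Proof.
move=> AF; elim: r => [|j r IHr].
  by apply: (funalg_ext algA) (funalgC algA 0) => t; rewrite big_nil.
case Pj: (P j); last first.
  by apply: (funalg_ext algA) IHr => t; rewrite big_cons Pj.
apply: (funalg_ext algA) (funalgD algA (AF _ Pj) IHr) => t.
by rewrite big_cons Pj.
Qed.

Lemma funalg_prod (J : Type) (r : seq J) (P : pred J) (F : J -> T -> K) :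
  (forall j, P j -> A (F j)) -> A (fun t => \prod_(j <- r | P j) F j t).
Proof.
move=> AF; elim: r => [|j r IHr].
  by apply: (funalg_ext algA) (funalgC algA 1) => t; rewrite big_nil.
case Pj: (P j); last first.
  by apply: (funalg_ext algA) IHr => t; rewrite big_cons Pj.
apply: (funalg_ext algA) (funalgM algA (AF _ Pj) IHr) => t.
by rewrite big_cons Pj.
Qed.

Lemma funalgX x n : A x -> A (fun t => x t ^+ n).
Proof.
move=> Ax; apply: (funalg_ext algA) (funalg_prod (index_iota 0 n) (P := predT)
  (F := fun=> x) _) => // t.
by rewrite big_const_nat subn0 iter_mulr_1.
Qed.

Lemma funalg_meval n (f : {mpoly K[n]}) (x : T -> 'I_n -> K) :
  (forall k, A (fun t => x t k)) -> A (fun t => f.@[x t]).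
Proof.
move=> Ax; apply: (funalg_ext algA (x := fun t =>
    \sum_(m <- msupp f) f@_m * \prod_i x t i ^+ m i)).
  by move=> t; rewrite mevalE.
apply: funalg_sum => m _; apply: (funalgM algA); first exact: (funalgC algA).
by apply: funalg_prod => i _; apply: funalgX.
Qed.

Definition mxfunalg m n (X : T -> 'M[K]_(m, n)) := forall i j, A (fun t => X t i j).

Lemma mxfunalgC m n (M : 'M[K]_(m, n)) : mxfunalg (fun=> M).
Proof. by move=> i j; apply: (funalgC algA). Qed.

Lemma mxfunalgD m n (X Y : T -> 'M[K]_(m, n)) :
  mxfunalg X -> mxfunalg Y -> mxfunalg (fun t => X t + Y t).
Proof.
move=> AX AY i j; apply: (funalg_ext algA) (funalgD algA (AX i j) (AY i j)) => t.
by rewrite mxE.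
Qed.

Lemma mxfunalgZ m n x (X : T -> 'M[K]_(m, n)) :
  A x -> mxfunalg X -> mxfunalg (fun t => x t *: X t).
Proof.
move=> Ax AX i j; apply: (funalg_ext algA) (funalgM algA Ax (AX i j)) => t.
by rewrite mxE.
Qed.

Lemma mxfunalgM m n p (X : T -> 'M[K]_(m, n)) (Y : T -> 'M[K]_(n, p)) :
  mxfunalg X -> mxfunalg Y -> mxfunalg (fun t => X t *m Y t).
Proof.
move=> AX AY i j.
apply: (funalg_ext algA (x := fun t => \sum_k X t i k * Y t k j)).
  by move=> t; rewrite mxE.
by apply: funalg_sum => k _; apply: (funalgM algA).
Qed.

Lemma funalg_det n (X : T -> 'M[K]_n) : mxfunalg X -> A (fun t => \det (X t)).
Proof.
move=> AX; apply: funalg_sum => s _; apply: (funalgM algA).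
  exact: (funalgC algA).
by apply: funalg_prod.
Qed.

Lemma mxfunalg_adj n (X : T -> 'M[K]_n) :
  mxfunalg X -> mxfunalg (fun t => \adj (X t)).
Proof.
move=> AX i j.
apply: (funalg_ext algA (x := fun t =>
    (-1) ^+ (j + i) * \det (row' j (col' i (X t))))).
  by move=> t; rewrite mxE.
apply: (funalgM algA); first exact: (funalgC algA).
apply: funalg_det => k l.
apply: (funalg_ext algA) (AX (fintype.lift j k) (fintype.lift i l)) => t.
by rewrite !mxE.
Qed.

End Closure.

(** Values of [x] off [U] are unconstrained, which allows partial operations such as [invmx]. *)
Definition rational_on (U : K -> Prop) (x : K -> K) :=
  exists P Q : {poly K}, forall t, U t -> Q.[t] != 0 /\ x t * Q.[t] = P.[t].

Lemma rational_on_ext (U : K -> Prop) x y : (forall t, U t -> x t = y t) ->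
  rational_on U x -> rational_on U y.
Proof.
by move=> xy [P [Q PQ]]; exists P, Q => t Ut; rewrite -xy //; apply: PQ.
Qed.

Lemma rational_on_funalg U : funalg (rational_on U).
Proof.
split.
- by move=> x y xy; apply: rational_on_ext => t _.
- by move=> c; exists c%:P, 1 => t _; rewrite !hornerE oner_eq0.
- move=> x y [P [Q PQ]] [R [S RS]]; exists (P * S + R * Q), (Q * S) => t Ut.
  have [[Q0 e1] [S0 e2]] := (PQ _ Ut, RS _ Ut).
  rewrite !hornerE mulf_neq0 //= -e1 -e2; split=> //.
  by rewrite !mulrDl (mulrAC (y t)).
- move=> x y [P [Q PQ]] [R [S RS]]; exists (P * R), (Q * S) => t Ut.
  have [[Q0 e1] [S0 e2]] := (PQ _ Ut, RS _ Ut).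
  rewrite !hornerE mulf_neq0 //= -e1 -e2; split=> //.
  by rewrite !mulrA (mulrAC (x t)).
Qed.

Lemma rational_on_id U : rational_on U id.
Proof. by exists 'X, 1 => t _; rewrite !hornerE oner_eq0. Qed.

Lemma rational_onV (U : K -> Prop) x : (forall t, U t -> x t != 0) ->
  rational_on U x -> rational_on U (fun t => (x t)^-1).
Proof.
move=> xN0 [P [Q PQ]]; exists Q, P => t Ut; have [Q0 <-] := PQ _ Ut.
by split; [rewrite mulf_neq0 ?xN0 | rewrite mulrA mulVf ?mul1r ?xN0].
Qed.

Lemma rational_on_invmx (U : K -> Prop) n (X : K -> 'M[K]_n) :
  (forall t, U t -> X t \in unitmx) -> mxfunalg (rational_on U) X ->
  mxfunalg (rational_on U) (fun t => invmx (X t)).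
Proof.
move=> unitX ratX i j; have algU := rational_on_funalg U.
apply: (rational_on_ext (x := fun t => (\det (X t))^-1 * \adj (X t) i j)).
  by move=> t Ut; rewrite /invmx unitX // [RHS]mxE.
apply: (funalgM algU); last exact: mxfunalg_adj.
apply: rational_onV; last exact: funalg_det.
by move=> t Ut; rewrite -unitfE -unitmxE unitX.
Qed.

(** This is the limit argument at zero. With [x] equal to [P / Q], the agreement off zero becomes a
    polynomial identity between [P] and [c *: Q] up to a power of ['X], which is then evaluated at
    zero. *)
Lemma rational_monomial (char0 : [pchar K] =i pred0) x (k : int) c :
    rational_on (fun=> True) x -> (forall t, t != 0 -> x t = t ^ k * c) ->
  [/\ c != 0 -> 0 <= k, k = 0 -> x 0 = c & 0 < k -> x 0 = 0].
Proof.
move=> [P [Q PQ]] xE; have Q0 t : Q.[t] != 0 by have [] := PQ t I.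
case: k xE => [[|k]|k] xE.
- split=> // _; apply: (mulIf (Q0 0)); rewrite (PQ 0 I).2.
  rewrite -hornerZ; congr (_.[0]); apply/eqP; rewrite -subr_eq0; apply/eqP.
  apply: (poly_eq0_punctured char0) => t tN0.
  by rewrite !hornerE -(PQ t I).2 xE // expr0z mul1r subrr.
- split=> // _; apply/eqP.
  have: x 0 * Q.[0] == 0; last by rewrite mulf_eq0 (negPf (Q0 0)) orbF.
  rewrite (PQ 0 I).2; suff -> : P = 'X^(k.+1) * (c *: Q).
    by rewrite hornerM hornerXn expr0n mul0r.
  apply/eqP; rewrite -subr_eq0; apply/eqP.
  apply: (poly_eq0_punctured char0) => t tN0.
  by rewrite hornerD hornerN hornerM hornerXn hornerZ -(PQ t I).2 xE // mulrA subrr.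
- split=> // cN0; suff : c *: Q = 'X^(k.+1) * P.
    move/(congr1 (fun p => p.[0])); rewrite hornerM hornerXn expr0n mul0r hornerZ => /eqP.
    by rewrite mulf_eq0 (negPf cN0) (negPf (Q0 0)).
  apply/eqP; rewrite -subr_eq0; apply/eqP.
  apply: (poly_eq0_punctured char0) => t tN0.
  rewrite hornerD hornerN hornerM hornerXn hornerZ -(PQ t I).2 xE // NegzE !mulrA.
  by rewrite -exprnN mulfV ?mul1r ?subrr // expf_neq0.
Qed.

End FunctionAlgebras.

(** * Module varieties, Zariski-closed sets and the stability of components under GL *)

Section Varieties.
Variables (K : fieldType) (Q : quiver).

Lemma fgliftE (V : lmodType K) (T : choiceType) (f : T -> V) D :
  fglift f D = \sum_(z <- dom D) coeff z D *: f z.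
Proof.
pose F := GRing.isAdditive.Build _ _ (fglift f) (lift_is_additive f).
pose G : {additive {freeg T / K} -> V} := HB.pack (fglift f) F.
rewrite -[in LHS](freeg_sumE D) -[fglift f]/(G : _ -> _) raddf_sum /=.
by apply: eq_bigr => z _; rewrite liftU.
Qed.

(** Induction on paths, then linearity. Two dimension vectors are allowed so that the lemma serves
    both base change and the inclusion of a summand. *)
Lemma rep_eval_intertwine (d e : vertex Q -> nat) (M : rep K d) (N : rep K e)
    (h : forall i, 'M[K]_(e i, d i)) :
    (forall a, h (hd a) *m M a = N a *m h (tl a)) ->
  forall x i j, h j *m rep_eval M x i j = rep_eval N x i j *m h i.
Proof.
move=> hMN x i j; rewrite /rep_eval !fgliftE mulmx_sumr mulmx_suml.
apply: eq_bigr => p _; rewrite -scalemxAr -scalemxAl; congr (_ *: _).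
elim: p => [|a p IHp] /=; first by rewrite mulmx1 mul1mx.
by rewrite mulmxA hMN -[RHS]mulmxA -IHp mulmxA.
Qed.

Variable d : vertex Q -> nat.
Implicit Types (M N : rep K d) (Z C D : rep K d -> Prop) (I : path_alg K Q -> Prop).
Implicit Types (g : forall i, 'M[K]_(d i)) (f : rep_poly K d).

Lemma poly_eval_ext f M N : (forall a, M a = N a) -> poly_eval f M = poly_eval f N.
Proof. by move=> MN; apply: meval_eq => k; rewrite /rep_coord MN. Qed.

Lemma zariski_closed_ext Z M N : zariski_closed Z ->
  (forall a, M a = N a) -> Z M -> Z N.
Proof.
move=> [S ZS] MN /ZS SM; apply/ZS => f Sf.
by rewrite -(poly_eval_ext f MN) SM.
Qed.

Definition polyfun (F : rep K d -> K) := exists f, forall M, F M = poly_eval f M.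

Lemma polyfun_funalg : funalg polyfun.
Proof.
split.
- by move=> x y xy [f fE]; exists f => M; rewrite -xy.
- by move=> c; exists c%:MP => M; rewrite /poly_eval mevalC.
- move=> x y [f fE] [g gE]; exists (f + g) => M.
  by rewrite fE gE /poly_eval mevalD.
- move=> x y [f fE] [g gE]; exists (f * g) => M.
  by rewrite fE gE /poly_eval mevalM.
Qed.

Lemma mxfunalg_coord a : mxfunalg polyfun (fun M : rep K d => M a).
Proof.
move=> i j; exists 'X_(enum_rank (existT _ a (i, j) : Defs.coord d)) => M.
by rewrite /poly_eval mevalXU /rep_coord enum_rankK.
Qed.

Lemma funalg_poly_eval T (A : (T -> K) -> Prop) (X : T -> rep K d) f :
    funalg A -> (forall a, mxfunalg A (fun t => X t a)) ->
  A (fun t => poly_eval f (X t)).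
Proof. by move=> algA AX; apply: funalg_meval => // k; apply: AX. Qed.

Lemma zariski_closed_mod_variety I : zariski_closed (mod_variety (d := d) I).
Proof.
exists (fun f => exists x i j k l, I x /\
  forall M, rep_eval M x i j k l = poly_eval f M) => M; split.
  by move=> IM f [x [i [j [k [l [Ix <-]]]]]]; rewrite IM // mxE.
move=> SM x Ix i j; apply/matrixP => k l; rewrite mxE.
suff [f fE] : polyfun (fun N => rep_eval N x i j k l).
  by rewrite fE SM //; exists x, i, j, k, l.
have algP := polyfun_funalg.
apply: (funalg_ext algP (x := fun N => \sum_(p <- dom (x i j))
    coeff p (x i j) * rep_path N p k l)).
  move=> N; rewrite /rep_eval fgliftE summxE; apply: eq_bigr => p _.
  by rewrite mxE.
apply: (funalg_sum algP) => p _; apply: (funalgM algP); first exact: (funalgC algP).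
apply: (_ : mxfunalg polyfun (fun N => rep_path N p)).
elim: p {k l} => [|a p IHp] /=; first exact: mxfunalgC.
by apply: mxfunalgM => //; apply: mxfunalg_coord.
Qed.

Lemma mod_variety_GL_act I g M : in_GL g -> mod_variety I M ->
  mod_variety I (GL_act g M).
Proof.
move=> gGL IM x Ix i j.
have gE a : g (hd a) *m M a = GL_act g M a *m g (tl a).
  by rewrite /GL_act mulmxKV // gGL.
have := rep_eval_intertwine gE x i j; rewrite IM // mulmx0.
by move/(congr1 (mulmx^~ (invmx (g i)))); rewrite mul0mx mulmxK ?gGL.
Qed.

Lemma mxfunalg_GL_act T (A : (T -> K) -> Prop) (X : T -> rep K d) g a :
    funalg A -> (forall a, mxfunalg A (fun t => X t a)) ->
  mxfunalg A (fun t => GL_act g (X t) a).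
Proof.
move=> algA AX; apply: (mxfunalgM algA); last exact: mxfunalgC.
by apply: (mxfunalgM algA) => //; apply: mxfunalgC.
Qed.

Lemma GL_act1 M a : GL_act (fun=> 1%:M) M a = M a.
Proof. by rewrite /GL_act invmx1 mul1mx mulmx1. Qed.

Lemma in_GL1 : in_GL (fun i => 1%:M : 'M[K]_(d i)).
Proof. by move=> i; apply: unitmx1. Qed.

Lemma in_GL_inv g : in_GL g -> in_GL (GL_inv g).
Proof. by move=> gGL i; rewrite unitmx_inv gGL. Qed.

(** The set is the intersection of all translates of [Z]; each is cut out by polynomials composed
    with the action of a fixed [g], which is linear in the matrix entries. *)
Lemma GL_core_closed Z : zariski_closed Z ->
  zariski_closed (fun M => forall g, in_GL g -> Z (GL_act g M)).
Proof.
move=> [S ZS]; exists (fun f => exists f' g, [/\ S f', in_GL g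
  & forall M, poly_eval f M = poly_eval f' (GL_act g M)]) => M; split.
  by move=> ZM f [f' [g [Sf' gGL ->]]]; move/ZS: (ZM g gGL); apply.
move=> SM g gGL; apply/ZS => f' Sf'.
have [f fE] : polyfun (fun N => poly_eval f' (GL_act g N)).
  apply: funalg_poly_eval => [|a]; first exact: polyfun_funalg.
  by apply: mxfunalg_GL_act; [apply: polyfun_funalg | apply: mxfunalg_coord].
by rewrite fE; apply: SM; exists f', g; split=> // N; rewrite fE.
Qed.

Hypothesis char0 : [pchar K] =i pred0.

(* If f1 does not vanish at g1 M and f2 does not vanish at g2 M, then neither
   vanishes at a general point of the line through g1 and g2. *)
Lemma orbit_irreducible M Z1 Z2 : zariski_closed Z1 -> zariski_closed Z2 ->
    (forall g, in_GL g -> Z1 (GL_act g M) \/ Z2 (GL_act g M)) ->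
  (forall g, in_GL g -> Z1 (GL_act g M)) \/ (forall g, in_GL g -> Z2 (GL_act g M)).
Proof.
have nonzero Z N : zariski_closed Z -> ~ Z N ->
    exists f, poly_eval f N != 0 /\ forall N', Z N' -> poly_eval f N' = 0.
  move=> [S ZS] nZ; apply: NNPP => nof; apply/nZ/ZS => f Sf; apply/eqP.
  apply: contraT => fN; case: nof; exists f; split=> // N' /ZS; exact.
move=> cl1 cl2 Z12; apply: NNPP => /not_or_and[n1 n2].
have [g1 ng] := not_all_ex_not _ _ n1; have [g1GL ng1] := imply_to_and _ _ ng.
have [f1 [f1N0 f1Z]] := nonzero _ _ cl1 ng1.
have [g2 {}ng] := not_all_ex_not _ _ n2; have [g2GL ng2] := imply_to_and _ _ ng.
have [f2 [f2N0 f2Z]] := nonzero _ _ cl2 ng2.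
pose h t i := g1 i + t *: (g2 i - g1 i).
have h0 i : h 0 i = g1 i by rewrite /h scale0r addr0.
have h1 i : h 1 i = g2 i by rewrite /h scale1r addrC subrK.
pose U t := in_GL (h t).
have U0 : U 0 by move=> i; rewrite h0.
have U1 : U 1 by move=> i; rewrite h1.
have rath V i : mxfunalg (rational_on V) (fun t => h t i).
  have algV := rational_on_funalg V.
  apply: (mxfunalgD algV); first exact: mxfunalgC.
  apply: (mxfunalgZ algV); last exact: mxfunalgC.
  exact: rational_on_id.
have ratf f : rational_on U (fun t => poly_eval f (GL_act (h t) M)).
  have algU := rational_on_funalg U.
  apply: (funalg_poly_eval (X := fun t => GL_act (h t) M)) => // a.
  apply: (mxfunalgM algU).
    by apply: (mxfunalgM algU) => //; apply: mxfunalgC.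
  by apply: rational_on_invmx => // t Ut; apply: Ut.
have [P1 [R1 PR1]] := ratf f1; have [P2 [R2 PR2]] := ratf f2.
(* Nonvanishing of this product will keep the chosen parameter inside [U]. *)
have [P3 [R3 PR3]] : rational_on (fun=> True) (fun t => \prod_i \det (h t i)).
  have algT := rational_on_funalg (K := K) (fun=> True).
  by apply: (funalg_prod algT) => i _; apply: (funalg_det algT).
have P1N0 : P1 != 0.
  apply: contraTneq f1N0 => P10; have [R10] := PR1 0 U0.
  rewrite P10 horner0 => /eqP; rewrite mulf_eq0 (negPf R10) orbF negbK.
  by congr (_ == 0); apply: poly_eval_ext => a; rewrite /GL_act !h0.
have P2N0 : P2 != 0.
  apply: contraTneq f2N0 => P20; have [R20] := PR2 1 U1.
  rewrite P20 horner0 => /eqP; rewrite mulf_eq0 (negPf R20) orbF negbK.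
  by congr (_ == 0); apply: poly_eval_ext => a; rewrite /GL_act !h1.
have P3N0 : P3 != 0.
  apply/eqP => P30; have [R30] := PR3 0 I.
  rewrite P30 horner0 => /eqP; rewrite mulf_eq0 (negPf R30) orbF => /prodf_eq0[i _].
  by rewrite h0; apply/negP; rewrite -unitfE -unitmxE g1GL.
have [|t] := poly_nonroot char0 (p := P1 * P2 * P3); first by rewrite !mulf_neq0.
rewrite !hornerM !mulf_eq0 !negb_or => /andP[/andP[P1t P2t] P3t].
have Ut : U t.
  move=> i; rewrite unitmxE unitfE; apply: contraNneq P3t => det0.
  by rewrite -(PR3 t I).2 (bigD1 i) //= det0 !mul0r.
case: (Z12 (h t) Ut) => [/f1Z f1t|/f2Z f2t].
  by case/eqP: P1t; rewrite -(PR1 t Ut).2 f1t mul0r.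
by case/eqP: P2t; rewrite -(PR2 t Ut).2 f2t mul0r.
Qed.

(** The closure [D] of the union of the orbits through [C] is irreducible: if two closed sets cover
    it, each orbit lies in one of them, so their GL-cores cover [C]. As [D] contains [C] and stays
    in the module variety, maximality gives [D = C]. *)
Lemma component_GL_stable I C : irreducible_component I C ->
  forall g M, in_GL g -> C M -> C (GL_act g M).
Proof.
move=> [clC [[N CN] irrC] CI maxC] g M gGL CM.
pose D N := forall f, (forall h L, in_GL h -> C L -> poly_eval f (GL_act h L) = 0) ->
  poly_eval f N = 0.
have DE h L : in_GL h -> C L -> D (GL_act h L) by move=> hGL CL f; apply.
have DS Z : zariski_closed Z -> (forall h L, in_GL h -> C L -> Z (GL_act h L)) ->
    forall L, D L -> Z L.
  move=> [S ZS] CZ L DL; apply/ZS => f Sf; apply: DL => h L' hGL CL'.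
  by move/ZS: (CZ h L' hGL CL'); apply.
have clD : zariski_closed D.
  by exists (fun f => forall h L, in_GL h -> C L -> poly_eval f (GL_act h L) = 0).
have CD L : C L -> D L.
  move=> CL; apply: (zariski_closed_ext clD) (DE _ L in_GL1 CL) => a.
  exact: GL_act1.
apply: (maxC D) => //; last exact: DE.
- split; first by exists N; apply: CD.
  move=> Z1 Z2 cl1 cl2 DZ.
  case: (irrC _ _ (GL_core_closed cl1) (GL_core_closed cl2)) => [L CL|CZ|CZ].
  + by apply: orbit_irreducible => // h hGL; apply/DZ/DE.
  + by left; apply: DS => // h L hGL CL; apply: CZ.
  + by right; apply: DS => // h L hGL CL; apply: CZ.
- apply: DS => [|h L hGL /CI]; first exact: zariski_closed_mod_variety.
  exact: mod_variety_GL_act.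
Qed.

Lemma irreducible_mul C f (g : rep_poly K d) : irreducible C ->
    (forall M, C M -> poly_eval (f * g) M = 0) ->
  (forall M, C M -> poly_eval f M = 0) \/ (forall M, C M -> poly_eval g M = 0).
Proof.
move=> [_ irrC] fg0; apply: irrC.
- by exists (eq f) => M; split=> [fM _ <-|->].
- by exists (eq g) => M; split=> [gM _ <-|->].
- move=> M /fg0 /eqP; rewrite /poly_eval mevalM mulf_eq0.
  by case/orP => /eqP; [left | right].
Qed.

End Varieties.

(** * One-parameter degenerations and the weights of subrepresentations *)

Section SemiInvariants.
Variables (K : fieldType) (Q : quiver) (d : vertex Q -> nat).
Hypothesis char0 : [pchar K] =i pred0.
Implicit Types (M N : rep K d) (f g : rep_poly K d).
Implicit Types (p e phi : forall i, 'M[K]_(d i)).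

Definition idempotent p := forall i, p i *m p i = p i.

Definition weight (theta : vertex Q -> int) p : int :=
  \sum_i theta i * (\rank (p i))%:Z.

(** Only the diagonal blocks of [M] for the splitting by [1 - p] and [p] are kept. When the image of
    the idempotent [p] is a subrepresentation N, this is N + M/N. *)
Definition degeneration p M : rep K d := fun a =>
  (1%:M - p (hd a)) *m M a *m (1%:M - p (tl a)) + p (hd a) *m M a *m p (tl a).

Lemma degeneration_endo p M e : rep_endo M e ->
    (forall i, e i *m p i = p i *m e i) ->
  rep_endo (degeneration p M) e.
Proof.
move=> Me ep a; rewrite /degeneration mulmxDr [RHS]mulmxDl.
have eq i : e i *m (1%:M - p i) = (1%:M - p i) *m e i.
  by rewrite mulmxBr mulmxBl mulmx1 mul1mx ep.
rewrite !mulmxA eq ep -![(_ *m e _) *m M a]mulmxA Me.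
by rewrite -![_ *m _ *m e _]mulmxA -eq -ep !mulmxA.
Qed.

Lemma degeneration_id p M a : idempotent p -> rep_endo M p ->
  degeneration p M a = M a.
Proof.
move=> pp Mp; rewrite /degeneration mulmxBr mulmx1 mulmxBl mul1mx mulmxBl.
rewrite -![p (hd a) *m M a *m _]mulmxA -Mp mulmxA pp.
by rewrite subrr subr0 subrK.
Qed.

(** A one-parameter subgroup of GL, acting by [t] on the image of [p] and trivially on its
    kernel. *)
Definition scaling p (t : K) i := 1%:M - p i + t *: p i.

Lemma scalingM p s t i : idempotent p ->
  scaling p s i *m scaling p t i = scaling p (s * t) i.
Proof.
move=> pp; rewrite /scaling.
have qp : (1%:M - p i) *m p i = 0 by rewrite mulmxBl mul1mx pp subrr.
have pq : p i *m (1%:M - p i) = 0 by rewrite mulmxBr mulmx1 pp subrr.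
have qq : (1%:M - p i) *m (1%:M - p i) = 1%:M - p i.
  by rewrite [LHS]mulmxBr mulmx1 qp subr0.
move: (1%:M - p i) qp pq qq => q qp pq qq.
rewrite mulmxDl !mulmxDr -!scalemxAl -!scalemxAr qp pq qq pp scalerA.
by rewrite !scaler0 addr0 add0r.
Qed.

Lemma scaling1 p i : scaling p 1 i = 1%:M.
Proof. by rewrite /scaling scale1r subrK. Qed.

Lemma scaling_unit p t i : idempotent p -> t != 0 -> scaling p t i \in unitmx.
Proof.
move=> pp tN0; case: (@mulmx1_unit _ _ (scaling p t i) (scaling p t^-1 i)) => //.
by rewrite scalingM // mulfV // scaling1.
Qed.

Lemma invmx_scaling p t i : idempotent p -> t != 0 ->
  invmx (scaling p t i) = scaling p t^-1 i.
Proof.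
move=> pp tN0; have uS := scaling_unit i pp tN0.
by apply: (can_inj (mulKmx uS)); rewrite mulmxV // scalingM // mulfV // scaling1.
Qed.

Lemma chi_scaling theta p t : idempotent p -> t != 0 ->
  chi theta (scaling p t) = t ^ weight theta p.
Proof.
move=> pp tN0; rewrite /chi /weight.
elim/big_rec2: _ => [|i y x _ ->]; first by rewrite expr0z.
rewrite expfzDr //; congr (_ * _).
by rewrite det_idempotent_scale // exprnP exprz_exp mulrC.
Qed.

Section Degeneration.
Variables (C : rep K d -> Prop) (theta : vertex Q -> int).
Hypothesis closedC : zariski_closed C.
Hypothesis stableC : forall (g : forall i, 'M[K]_(d i)) M,
  in_GL g -> C M -> C (GL_act g M).

(** The condition on arrows says that the image of [p] is a subrepresentation. Moving [M] by
    [scaling p t] then multiplies the one off-diagonal block left by [t], and the value of [f] by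
    [t] to the power [- weight theta p]. Letting [t] go to zero gives all claims. *)
Lemma degenerationP p M : idempotent p ->
    (forall a, M a *m p (tl a) = p (hd a) *m M a *m p (tl a)) -> C M ->
  C (degeneration p M) /\
  forall f, semi_invariant C theta f ->
    [/\ poly_eval f M != 0 -> weight theta p <= 0,
        weight theta p = 0 -> poly_eval f (degeneration p M) = poly_eval f M
      & weight theta p < 0 -> poly_eval f (degeneration p M) = 0].
Proof.
move=> pp sub CM.
pose A (t : K) : rep K d := fun a =>
  degeneration p M a + t *: (p (hd a) *m M a *m (1%:M - p (tl a))).
have A0 a : A 0 a = degeneration p M a by rewrite /A scale0r addr0.
have AE t a : t != 0 -> GL_act (GL_inv (scaling p t^-1)) M a = A t a.
  move=> tN0; have tVN0 : t^-1 != 0 by rewrite invr_eq0.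
  rewrite /GL_act /GL_inv invmxK invmx_scaling // invrK.
  have qMp : (1%:M - p (hd a)) *m M a *m p (tl a) = 0.
    by rewrite !mulmxBl mul1mx -sub subrr.
  rewrite /A /degeneration /scaling.
  move: (1%:M - p (hd a)) (1%:M - p (tl a)) qMp => q q' qMp.
  rewrite mulmxDl [LHS]mulmxDl !mulmxDr -!(scalemxAl, scalemxAr) qMp !scaler0.
  by rewrite scalerA mulfV // scale1r addr0 addrAC addrA.
have CA t : t != 0 -> C (A t).
  move=> tN0; apply: (zariski_closed_ext closedC) (fun a => AE t a tN0) _.
  apply: stableC => //; apply: in_GL_inv => i.
  by apply: scaling_unit; rewrite ?invr_eq0.
have ratA f : rational_on (fun=> True) (fun t => poly_eval f (A t)).
  have algT := rational_on_funalg (K := K) (fun=> True).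
  apply: (funalg_poly_eval (X := A)) => // a.
  apply: (mxfunalgD algT); first exact: mxfunalgC.
  by apply: (mxfunalgZ algT); [apply: rational_on_id | apply: mxfunalgC].
split=> [|f sf].
  (* A defining equation of [C] vanishes along the curve off zero, hence also in the limit: this is
     the monomial case with exponent and coefficient zero. *)
  apply: (zariski_closed_ext closedC A0); case: closedC => S CS; apply/CS => f Sf.
  have [|_ -> //] := rational_monomial (k := 0) (c := 0) char0 (ratA f).
  by move=> t tN0; rewrite mulr0; move/CS: (CA t tN0); apply.
have [|le0 eq0 lt0] := rational_monomial (k := - weight theta p)
    (c := poly_eval f M) char0 (ratA f).
  move=> t tN0; rewrite -(poly_eval_ext _ (fun a => AE t a tN0)).
  have tVN0 : t^-1 != 0 by rewrite invr_eq0.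
  rewrite sf // => [|i]; last exact: scaling_unit.
  by rewrite chi_scaling // -exprz_inv.
rewrite -(poly_eval_ext _ A0).
by split=> [/le0|w0|w0]; rewrite ?oppr_ge0 //; [apply: eq0 | apply: lt0];
  rewrite ?w0 ?oppr0 ?oppr_gt0.
Qed.

(** Degenerating along an endomorphism leaves [M] unchanged, so a negative weight would force [f] to
    vanish at [M]. *)
Lemma weight_endo p M f : idempotent p -> rep_endo M p -> C M ->
  semi_invariant C theta f -> poly_eval f M != 0 -> weight theta p = 0.
Proof.
move=> pp Mp CM sf fM; have [|_ /(_ f sf)[le0 _ lt0]] := degenerationP pp _ CM.
  by move=> a; rewrite Mp -mulmxA pp.
apply/eqP; rewrite eq_le le0 //= leNgt; apply: contra fM => /lt0 <-.
by apply/eqP; apply: poly_eval_ext => a; rewrite degeneration_id.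
Qed.

End Degeneration.
End SemiInvariants.

(** * Decompositions into summands on which nonzero endomorphisms are injective *)

Section Decompositions.
Variables (K : fieldType) (Q : quiver) (d : vertex Q -> nat).
Hypothesis char0 : [pchar K] =i pred0.
Implicit Types (M N : rep K d) (f g : rep_poly K d).
Implicit Types (p phi : forall i, 'M[K]_(d i)).

(** A complete system of [m] nonzero orthogonal idempotents of End(M). Indices are natural numbers
    guarded by [m], so that a further idempotent can be appended at [m]. *)
Definition decomposition M m (e : nat -> forall i, 'M[K]_(d i)) :=
  [/\ forall k, (k < m)%N -> rep_endo M (e k),
      forall k l i, (k < m)%N -> (l < m)%N ->
        e k i *m e l i = if k == l then e k i else 0,
      forall i, \sum_(k < m) e k i = 1%:M
    & forall k, (k < m)%N -> exists i, e k i != 0].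

(** At each vertex the ranks add up to [d i] by traces, and every idempotent contributes at least
    one to the total. The bound makes repeated splitting stop. *)
Lemma decomposition_size M m e : decomposition M m e -> (m <= \sum_i d i)%N.
Proof.
move=> [_ ee e1 eN0].
have rank_sum i : (\sum_(k < m) \rank (e k i))%N = d i.
  apply: (natr_inj_char0 char0); rewrite /= natr_sum -mxtrace1 -e1 raddf_sum.
  by apply: eq_bigr => k _; rewrite /= -mxtrace_idempotent // ee ?ltn_ord ?eqxx.
rewrite -(eq_bigr _ (fun i _ => rank_sum i)) exchange_big /=.
rewrite -[leqLHS]card_ord -sum1_card; apply: leq_sum => k _.
have [i ei] := eN0 k (ltn_ord k).
by rewrite (bigD1 i) //= ltn_addr // lt0n mxrank_eq0.
Qed.

(** For an idempotent endomorphism [p], the maps [phi] fixed by [p] on both sides are the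
    endomorphisms of the summand cut out by [p]; the nonzero ones are required to be injective on
    it. *)
Definition division_summand M p :=
  forall phi, rep_endo M phi -> (forall i, p i *m phi i = phi i) ->
    (forall i, phi i *m p i = phi i) ->
  (exists i (w : 'cV_(d i)), [/\ w != 0, p i *m w = w & phi i *m w = 0]) ->
  forall i, phi i = 0.

Section Split.
Variables (C : rep K d -> Prop) (theta : vertex Q -> int) (f g : rep_poly K d).
Hypothesis closedC : zariski_closed C.
Hypothesis stableC : forall (g : forall i, 'M[K]_(d i)) M,
  in_GL g -> C M -> C (GL_act g M).
Hypothesis semif : semi_invariant C theta f.
Hypothesis semig : semi_invariant C theta g.

Definition on_fibre lambda M :=
  [/\ C M, poly_eval g M != 0 & poly_eval f M = lambda * poly_eval g M].

(* The kernel and the image of an endomorphism of a summand are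
   subrepresentations whose weights are nonpositive and add up to that of the
   summand, which is zero; so the degeneration to kernel plus cokernel does not
   change the values of f and g. *)
Lemma split_summand lambda M m e k phi : on_fibre lambda M ->
    decomposition M m e -> (k < m)%N -> rep_endo M phi ->
    (forall i, e k i *m phi i = phi i) -> (forall i, phi i *m e k i = phi i) ->
    (exists i (w : 'cV_(d i)), [/\ w != 0, e k i *m w = w & phi i *m w = 0]) ->
    (exists i, phi i != 0) ->
  exists M' e', on_fibre lambda M' /\ decomposition M' m.+1 e'.
Proof.
move=> [CM gM fM] [Me ee e1 eN0] km Mphi ephi phie [i0 [w [wN0 ew phiw]]] [j0 phiN0].
have ekek i : e k i *m e k i = e k i by rewrite ee // eqxx.
(* [gam] is a generalized inverse taken vertex by vertex, with no regard to the arrows. Then [pi]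
   projects onto the kernel of [phi] in the summand, [rho] onto a complement of it there, and [sig]
   onto the image of [phi]. *)
have [gam pgp] : exists gam : forall i, 'M_(d i),
    forall i, phi i *m gam i *m phi i = phi i.
  by exists (fun i => pinvmx (phi i)) => i; apply: mulmxKpV.
pose rho i := e k i *m gam i *m phi i.
pose sig i := phi i *m gam i *m e k i.
pose pi i := e k i - rho i.
have prho i : phi i *m rho i = phi i by rewrite /rho !mulmxA phie pgp.
have ppi i : phi i *m pi i = 0 by rewrite mulmxBr prho phie subrr.
have rr : idempotent rho by move=> i; rewrite {1}/rho -mulmxA prho.
have er i : e k i *m rho i = rho i by rewrite /rho !mulmxA ekek.
have re i : rho i *m e k i = rho i by rewrite /rho -mulmxA phie.
have ep i : e k i *m pi i = pi i by rewrite mulmxBr ekek er.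
have pe i : pi i *m e k i = pi i by rewrite mulmxBl ekek re.
have rp i : rho i *m pi i = 0 by rewrite mulmxBr re rr subrr.
have pr i : pi i *m rho i = 0 by rewrite mulmxBl er rr subrr.
have pp : idempotent pi by move=> i; rewrite {2}/pi mulmxBr pe pr subr0.
have ss : idempotent sig.
  move=> i; rewrite /sig -!mulmxA [e k i *m (_ *m _)]mulmxA ephi.
  by rewrite !mulmxA pgp.
have sphi i : sig i *m phi i = phi i by rewrite /sig -mulmxA ephi pgp.
have rhoE i : rho i = e k i - pi i by rewrite /pi subKr.
have piw : pi i0 *m w = w by rewrite mulmxBl ew -[X in w - X]mulmxA phiw mulmx0 subr0.
have subp a : M a *m pi (tl a) = pi (hd a) *m M a *m pi (tl a).
  have eMp : e k (hd a) *m M a *m pi (tl a) = M a *m pi (tl a).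
    by rewrite Me // -mulmxA ep.
  have rMp : rho (hd a) *m M a *m pi (tl a) = 0.
    by rewrite /rho -!mulmxA [phi _ *m _]mulmxA Mphi -mulmxA ppi !mulmx0.
  by rewrite {2}/pi !mulmxBl eMp rMp subr0.
have subs a : M a *m sig (tl a) = sig (hd a) *m M a *m sig (tl a).
  rewrite {1 3}/sig !mulmxA -Mphi; congr (_ *m _ *m _).
  by rewrite -[RHS]mulmxA -Mphi mulmxA sphi.
have we : weight theta (e k) = 0.
  by apply: (weight_endo char0 closedC stableC _ (Me k km) CM semig gM).
(* Both ranks equal the trace of [phi i *m gam i]. *)
have wsr : weight theta sig = weight theta rho.
  apply: eq_bigr => i _; congr (_ * Posz _); apply: (natr_inj_char0 char0) => /=.
  rewrite -!mxtrace_idempotent // mxtrace_mulC mulmxA ephi.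
  by rewrite -[RHS]mxtrace_mulC mulmxA phie.
have wpr : weight theta pi + weight theta rho = 0.
  rewrite -we -big_split; apply: eq_bigr => i _ /=.
  rewrite -mulrDr -PoszD -mxrank_add_idempotent //.
  by rewrite rhoE addrC subrK.
have [CM' semiM'] := degenerationP char0 theta closedC stableC pp subp CM.
have wp0 : weight theta pi = 0.
  have [wp _ _] := semiM' g semig.
  have [_ /(_ g semig)[wsig _ _]] := degenerationP char0 theta closedC stableC ss subs CM.
  apply/eqP; rewrite eq_le wp //= -oppr_le0.
  by rewrite (addr0_eq wpr) -wsr wsig.
have [_ /(_ wp0) fM' _] := semiM' f semif.
have [_ /(_ wp0) gM' _] := semiM' g semig.
clearbody pi sig rho.
(* [pi] takes the place of [e k], and [rho] is appended at index [m]. *)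
exists (degeneration pi M),
  (fun l => if l == m then rho else if l == k then pi else e l).
split; first by split; rewrite ?fM' ?gM'.
have kNm : k == m = false by rewrite ltn_eqF.
have elp l i : (l < m)%N -> l != k ->
    [/\ e l i *m pi i = 0, pi i *m e l i = 0, e l i *m rho i = 0 & rho i *m e l i = 0].
  move=> lm lk.
  have lek : e l i *m e k i = 0 by rewrite ee // (negPf lk).
  have kel : e k i *m e l i = 0 by rewrite ee // eq_sym (negPf lk).
  by rewrite -ep -pe -er -re !mulmxA lek -!mulmxA kel !mul0mx !mulmx0.
have endoe l : (l < m)%N -> rep_endo (degeneration pi M) (e l).
  move=> lm; apply: degeneration_endo => [|i]; first exact: Me.
  by case: (eqVneq l k) => [->|/(elp l i lm)[-> -> _ _]] //; rewrite ep pe.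
(* The degeneration is block diagonal for [pi], so [pi], and with it [rho], becomes an
   endomorphism. *)
have endop : rep_endo (degeneration pi M) pi.
  have pq i : pi i *m (1%:M - pi i) = 0 by rewrite mulmxBr mulmx1 pp subrr.
  have qp i : (1%:M - pi i) *m pi i = 0 by rewrite mulmxBl mul1mx pp subrr.
  move=> a; rewrite /degeneration mulmxDr [RHS]mulmxDl !mulmxA pq pp !mul0mx.
  by rewrite -!(mulmxA _ _ (pi (tl a))) qp pp !mulmx0 !add0r.
split.
- move=> l; rewrite ltnS leq_eqVlt; case: (eqVneq l m) => [-> _|_ /= lm] a.
    by rewrite !rhoE mulmxBl mulmxBr endoe ?endop.
  by case: (eqVneq l k) => [_|_]; [apply: endop | apply: endoe].
- move=> l l' i; rewrite !ltnS (leq_eqVlt l) (leq_eqVlt l').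
  case: (eqVneq l m) => [->|lNm] /=; case: (eqVneq l' m) => [->|l'Nm] /=.
  + by rewrite ?eqxx rr.
  + by move=> _ l'm; case: (eqVneq l' k) => [_|/(elp l' i l'm)[_ _ _ ->]].
  + by move=> lm _; rewrite (negPf lNm); case: (eqVneq l k) => [_|/(elp l i lm)[_ _ -> _]].
  + move=> lm l'm; case: (eqVneq l k) => [->|lk]; case: (eqVneq l' k) => [l'k|l'k].
    * by rewrite pp ?eqxx.
    * by have [_ -> _ _] := elp l' i l'm l'k.
    * by have [-> _ _ _] := elp l i lm lk; rewrite l'k (negPf lk).
    * exact: ee.
- move=> i; rewrite big_ord_recr /= eqxx -(e1 i).
  rewrite (bigD1 (Ordinal km)) //= [RHS](bigD1 (Ordinal km)) //= kNm eqxx.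
  rewrite rhoE addrAC [pi i + _]addrC subrK; congr (_ + _); apply: eq_bigr => l lk.
  rewrite ltn_eqF ?ltn_ord //; case: eqP => // lkE.
  by case/eqP: lk; apply: val_inj.
- move=> l; rewrite ltnS leq_eqVlt; case: (eqVneq l m) => [-> _|_ /= lm].
    exists j0; apply: contraNneq phiN0 => r0.
    by rewrite -prho r0 mulmx0.
  case: (eqVneq l k) => [_|_]; last exact: eN0.
  exists i0; apply: contraNneq wN0 => p0.
  by rewrite -piw p0 mul0mx.
Qed.

(** Splitting is repeated while some summand has a nonzero non-injective endomorphism. Each split
    raises [m] and keeps [lambda], so the induction runs on the gap [\sum_i d i - m]. *)
Lemma exists_division_decomposition lambda M : on_fibre lambda M ->
  exists M' m e, [/\ on_fibre lambda M', decomposition M' m e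
    & forall k, (k < m)%N -> division_summand M' (e k)].
Proof.
move=> fibM; have [m [e dec]] : exists m e, decomposition M m e.
  (* The start is the identity alone; in dimension zero the identity is zero, so the empty
     decomposition is taken. *)
  case: (classic (exists i, d i != 0%N)) => [[i0 di0]|d0].
    exists 1%N, (fun _ i => 1%:M); split.
    - by move=> k _ a; rewrite mul1mx mulmx1.
    - by move=> [|k] [|l] i // _ _; rewrite mul1mx.
    - by move=> i; rewrite big_ord1.
    - by move=> k _; exists i0; rewrite -mxrank_eq0 mxrank1.
  exists 0%N, (fun _ i => 0); split=> // i.
  rewrite big_ord0; apply/matrixP => j; case: d0; exists i.
  by apply/eqP => di0; have := ltn_ord j; rewrite [X in (_ < X)%N]di0.
have [n] := ubnP (\sum_i d i - m)%N.
elim: n M m e fibM dec => // n IHn M m e fibM dec lt_n.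
case: (classic (forall k, (k < m)%N -> division_summand M (e k))) => [div|].
  by exists M, m, e.
move=> /not_all_ex_not[k nodivk]; have [km nodiv] := imply_to_and _ _ nodivk.
have [phi nphi] := not_all_ex_not _ _ nodiv.
have [Mphi {}nphi] := imply_to_and _ _ nphi.
have [ephi {}nphi] := imply_to_and _ _ nphi.
have [phie {}nphi] := imply_to_and _ _ nphi.
have [ker {}nphi] := imply_to_and _ _ nphi.
have [i /eqP phiN0] := not_all_ex_not _ _ nphi.
have [M' [e' [fibM' dec']]] := split_summand fibM dec km Mphi ephi phie ker
  (ex_intro _ i phiN0).
have m_lt := decomposition_size dec'; apply: IHn fibM' dec' _.
exact: leq_trans (ltn_sub2l m_lt (ltnSn m)) lt_n.
Qed.

End Split.
End Decompositions.

(** * Direct sums given by inclusions and projections *)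

Section Presentations.
Variables (K : fieldType) (Q : quiver) (d : vertex Q -> nat).
Implicit Types (M N : rep K d).

(** Inclusions [u] and projections [v] replace block matrices of varying sizes. Compatibility of the
    projections with the arrows follows from that of the inclusions. *)
Definition direct_sum_of (J : finType) (r : J -> vertex Q -> nat)
    (X : forall j, rep K (r j)) M :=
  exists (u : forall j i, 'M[K]_(d i, r j i)) (v : forall j i, 'M[K]_(r j i, d i)),
  [/\ forall i, \sum_j u j i *m v j i = 1%:M,
      forall j k i, j != k -> v j i *m u k i = 0,
      forall j i, v j i *m u j i = 1%:M
    & forall j a, M a *m u j (tl a) = u j (hd a) *m X j a].

Lemma direct_sum_iso (J : finType) r (X : forall j : J, rep K (r j)) M N :
  direct_sum_of X M -> direct_sum_of X N -> rep_iso M N.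
Proof.
move=> [u [v [uv1 vu0 vu1 Mu]]] [u' [v' [uv1' vu0' vu1' Nu']]].
have vu j k i : v j i *m u k i *m v' k i = if j == k then v' j i else 0.
  by case: (eqVneq j k) => [->|jk]; [rewrite vu1 mul1mx | rewrite vu0 ?mul0mx].
pose h i := \sum_j u' j i *m v j i.
have hu k i : h i *m u k i = u' k i.
  rewrite mulmx_suml (bigD1 k) //= -mulmxA vu1 mulmx1 big1 ?addr0 // => j jk.
  by rewrite -mulmxA vu0 ?mulmx0.
exists h.
  move=> i; case: (@mulmx1_unit _ _ (h i) (\sum_j u j i *m v' j i)) => //.
  by rewrite mulmx_sumr -(uv1' i); apply: eq_bigr => j _; rewrite mulmxA hu.
move=> a; rewrite -[M a]mulmx1 -(uv1 (tl a)) !mulmx_sumr.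
apply: eq_bigr => j _.
by rewrite [M a *m _]mulmxA Mu -mulmxA mulmxA hu !mulmxA Nu'.
Qed.

End Presentations.

(** The factor does not depend on [f], so ratios of semi-invariants of equal weight are constant on
    orbits. *)
Lemma semi_invariant_GL_act (K : fieldType) (Q : quiver) (d : vertex Q -> nat)
    (C : rep K d -> Prop) theta f h M :
    semi_invariant C theta f -> in_GL h -> C M ->
  poly_eval f (GL_act h M) = chi theta (GL_inv h) * poly_eval f M.
Proof.
move=> semif hGL CM; rewrite -semif //; last exact: in_GL_inv.
by apply: poly_eval_ext => a; rewrite /GL_act /GL_inv !invmxK.
Qed.

(** Whether [R] assigns a value to a point is decided classically, one point of [T] at a time. *)
Lemma list_of_finite_relation (K : eqType) (T : finType) (R : T -> K -> Prop) :
    (forall t x y, R t x -> R t y -> x = y) ->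
  exists s : seq K, forall t x, R t x -> x \in s.
Proof.
move=> Runiq.
suff [s Rs] : exists s : seq K, forall t, t \in enum T -> forall x, R t x -> x \in s.
  by exists s => t x; apply: Rs; rewrite mem_enum.
elim: (enum T) => [|t r [s Rs]]; first by exists [::].
case: (classic (exists x, R t x)) => [[x Rx]|nR].
  exists (x :: s) => t'; rewrite inE => /predU1P[-> y Ry|t'r y Ry].
    by rewrite (Runiq _ _ _ Ry Rx) mem_head.
  by rewrite inE (Rs _ t'r) ?orbT.
exists s => t'; rewrite inE => /predU1P[-> y Ry|]; last exact: Rs.
by case: nR; exists y.
Qed.

(** * Summands of a representation and Schur's lemma *)

Section SchurSummands.
Variables (K : closedFieldType) (Q : quiver) (I : path_alg K Q -> Prop).
Variables (d r : vertex Q -> nat) (M : rep K d) (p : forall i, 'M[K]_(d i)).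
Variables (u : forall i, 'M[K]_(d i, r i)) (v : forall i, 'M[K]_(r i, d i)).
Hypothesis uv : forall i, u i *m v i = p i.
Hypothesis vu : forall i, v i *m u i = 1%:M.
Hypothesis Mp : rep_endo M p.

(** The summand cut out by the idempotent [p], written in the coordinates of a splitting of [p] so
    that its dimension vector is [r]. *)
Definition summand : rep K r := fun a => v (hd a) *m M a *m u (tl a).

Lemma summand_inj a : u (hd a) *m summand a = M a *m u (tl a).
Proof. by rewrite /summand !mulmxA uv Mp -mulmxA -uv -mulmxA vu mulmx1. Qed.

Lemma summand_proj a : v (hd a) *m M a = summand a *m v (tl a).
Proof.
rewrite /summand -[RHS]mulmxA uv.
by rewrite -[RHS]mulmxA -Mp mulmxA -uv mulmxA vu mul1mx.
Qed.

Lemma mod_variety_summand : mod_variety I M -> mod_variety I summand.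
Proof.
move=> IM x Ix i j; have := rep_eval_intertwine summand_inj x i j.
rewrite IM // mul0mx => /(congr1 (mulmx (v j))).
by rewrite mulmxA vu mul1mx mulmx0.
Qed.

Lemma eigenvectorP n (A : 'M[K]_n) : (0 < n)%N ->
  exists c (w : 'cV_n), w != 0 /\ A *m w = c *: w.
Proof.
(* [eigenvalue] concerns row vectors, hence the transpose. *)
move=> n_gt0; have /closed_rootP[c] : size (char_poly A^T) != 1%N.
  by rewrite size_char_poly; case: n n_gt0 {A}.
rewrite -eigenvalue_root_char => /eigenvalueP[w wA wN0].
exists c, w^T; split; first by rewrite trmx_eq0.
by rewrite -[A]trmxK -trmx_mul wA linearZ.
Qed.

(** Schur's lemma: an endomorphism [psi] has an eigenvalue [c] at a vertex where the summand is
    nonzero. Extended by zero to [M], the map [psi - c] kills an eigenvector, so it vanishes by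
    [division_summand]. *)
Lemma schur_summand : (exists i, p i != 0) -> division_summand M p -> schur summand.
Proof.
move=> [i0 p0] div.
have r0 : (0 < r i0)%N.
  rewrite lt0n; apply: contraNneq p0 => r0; apply/eqP; rewrite -uv.
  apply/matrixP => a b; rewrite !mxE big1 // => k; have := ltn_ord k.
  by rewrite [X in (_ < X)%N]r0.
exists (fun c i => c%:M); split.
- by move=> c a; rewrite scalar_mxC.
- move=> psi psiE; have [c [w [wN0 psiw]]] := eigenvectorP (psi i0) r0.
  exists c => i; pose phi j := u j *m (psi j - c%:M) *m v j.
  have: phi i = 0.
    apply: div.
    + move=> a; rewrite /phi -[LHS]mulmxA summand_proj [LHS]mulmxA.
      have psicE : (psi (hd a) - c%:M) *m summand a
                 = summand a *m (psi (tl a) - c%:M).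
        by rewrite mulmxBl mulmxBr psiE scalar_mxC.
      by rewrite -(mulmxA (u (hd a))) psicE (mulmxA (u (hd a))) summand_inj -!mulmxA.
    + by move=> j; rewrite /phi -uv !mulmxA -[u j *m v j *m _]mulmxA vu mulmx1.
    + by move=> j; rewrite /phi -uv -!mulmxA [v j *m (u j *m _)]mulmxA vu mul1mx.
    exists i0, (u i0 *m w); split.
    + apply: contraNneq wN0 => uw0.
      by rewrite -[w]mul1mx -(vu i0) -mulmxA uw0 mulmx0.
    + by rewrite -uv -mulmxA [v i0 *m _]mulmxA vu mul1mx.
    + rewrite /phi -!mulmxA [v i0 *m _]mulmxA vu mul1mx mulmxBl psiw.
      by rewrite mul_scalar_mx subrr mulmx0.
  move/(congr1 (fun A => v i *m A *m u i)); rewrite mulmx0 mul0mx /phi !mulmxA.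
  by rewrite vu mul1mx -mulmxA vu mulmx1 => /eqP; rewrite subr_eq0 => /eqP.
- move=> b c /(_ i0) /matrixP/(_ (Ordinal r0) (Ordinal r0)).
  by rewrite !mxE eqxx.
- split=> // b c i.
  + by rewrite raddfD.
  + by rewrite -scalar_mxM.
  + by rewrite scale_scalar_mx.
Qed.

End SchurSummands.

(** * Finitely many values of f / g *)

Section FinitelyManyValues.
Variables (K : closedFieldType) (Q : quiver) (I : path_alg K Q -> Prop).
Hypothesis char0 : [pchar K] =i pred0.
Hypothesis schurI : schur_rep_finite I.
Variables (d : vertex Q -> nat) (C : rep K d -> Prop) (theta : vertex Q -> int).
Variables (f g : rep_poly K d).
Hypothesis compC : irreducible_component I C.
Hypothesis semif : semi_invariant C theta f.
Hypothesis semig : semi_invariant C theta g.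

(** Every value is attained at a direct sum of Schur representations, each taken from the finite
    list for its dimension vector. Isomorphic representations give equal values, and [T] encodes the
    finitely many such sums. *)
Lemma finitely_many_values : exists s : seq K, forall x,
  (exists M, on_fibre C f g x M) -> x \in s.
Proof.
have [closedC _ CI _] := compC; have stableC := component_GL_stable char0 compC.
(* [D] bounds both the number of summands and the entries of their dimension vectors, which makes
   [dimv] and [T] finite. *)
pose D := (\sum_i d i)%N.
pose dimv := {ffun vertex Q -> 'I_D.+1}.
pose dim (r : dimv) i : nat := r i.
have [n] : exists n : dimv -> nat, forall r, exists S : 'I_(n r) -> rep K (dim r),
    forall M, mod_variety I M -> schur M -> exists k, rep_iso M (S k).
  by apply: (fin_all_exists (P := fun r n => exists S : 'I_n -> rep K (dim r),
    forall M, mod_variety I M -> schur M -> exists k, rep_iso M (S k))).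
move/fin_all_exists => [S SP].
pose F := {r : dimv & 'I_(n r)}.
pose T := {m : 'I_D.+1 & {ffun 'I_m -> F}}.
pose X (t : T) (j : 'I_(tag t)) : rep K (dim (tag (tagged t j))) :=
  S _ (tagged (tagged t j)).
have [|s sP] := @list_of_finite_relation K T
  (fun t x => exists2 M, on_fibre C f g x M & direct_sum_of (@X t) M).
  move=> t x y [M [CM gM fM] tM] [N [CN gN fN] tN].
  have [h hGL hMN] := direct_sum_iso tM tN.
  have NE a : GL_act h M a = N a by rewrite /GL_act hMN mulmxK ?hGL.
  have := semi_invariant_GL_act semif hGL CM.
  rewrite (poly_eval_ext f NE) fN fM mulrCA -(semi_invariant_GL_act semig hGL CM).
  by rewrite (poly_eval_ext g NE) => /(mulIf gN).
exists s => x [M0 fib0].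
have [M [m [e [fibM dec div]]]] :=
  exists_division_decomposition char0 closedC stableC semif semig fib0.
have [Me ee e1 eN0] := dec; have m_lt : (m < D.+1)%N := decomposition_size char0 dec.
pose P (j : 'I_m) (w : F) :=
  exists (u : forall i, 'M[K]_(d i, dim (tag w) i))
         (v : forall i, 'M[K]_(dim (tag w) i, d i)),
  [/\ forall i, v i *m u i = 1%:M, forall i, u i *m v i = e j i
    & forall a, M a *m u (tl a) = u (hd a) *m S _ (tagged w) a].
have [phi phiP] : exists phi, forall j, P j (phi j).
  apply: fin_all_exists => j.
  (* [inord] loses nothing here, as the rank is at most [d i], hence at most [D]. *)
  pose r : dimv := [ffun i => inord (\rank (e j i))].
  have dimE i : dim r i = \rank (e j i).
    rewrite /dim ffunE inordK // ltnS (leq_trans (rank_leq_row _)) //.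
    by rewrite /D (bigD1 i) //= leq_addr.
  have split_e i : exists uv : 'M[K]_(d i, dim r i) * 'M[K]_(dim r i, d i),
      uv.2 *m uv.1 = 1%:M /\ uv.1 *m uv.2 = e j i.
    rewrite dimE; exists (col_base (e j i), row_base (e j i)).
    by rewrite /= mulmx_base idempotent_split // ee // eqxx.
  have [uv uvP] := fin_all_exists split_e.
  pose u i := (uv i).1; pose v i := (uv i).2.
  have vu i : v i *m u i = 1%:M by have [] := uvP i.
  have uve i : u i *m v i = e j i by have [] := uvP i.
  have Mej := Me j (ltn_ord j); have [CM _ _] := fibM.
  have [k [h hGL hE]] := SP r (summand M u v)
    (mod_variety_summand uve vu Mej (CI _ CM))
    (schur_summand uve vu Mej (eN0 j (ltn_ord j)) (div j (ltn_ord j))).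
  (* The splitting is corrected by the isomorphism [h], so that the summand becomes the listed
     representation itself. *)
  exists (existT _ r k), (fun i => u i *m invmx (h i)), (fun i => h i *m v i).
  split=> [i|i|a] /=.
  - by rewrite mulmxA -[h i *m _ *m _]mulmxA vu mulmx1 mulmxV ?hGL.
  - by rewrite mulmxA mulmxKV ?hGL.
  - rewrite mulmxA -(summand_inj uve vu Mej) -[LHS]mulmxA -[RHS]mulmxA; congr (_ *m _).
    have hu i := hGL i; apply: (can_inj (mulKmx (hu (hd a)))).
    by rewrite [RHS]mulmxA mulmxV // mul1mx mulmxA hE mulmxK.
pose t : T := existT _ (Ordinal m_lt) [ffun j => phi j].
apply: (sP t); exists M => //.
have {phiP} tP (j : 'I_(tag t)) : P j (tagged t j) by rewrite /= ffunE.
have [u /fin_all_exists[v uvP]] := fin_all_exists tP.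
exists u, v; split.
- by move=> i; rewrite -(e1 i); apply: eq_bigr => j _; have [_ -> _] := uvP j.
- move=> j k i jk; have [vuj uvj _] := uvP j; have [vuk uvk _] := uvP k.
  rewrite -[v j i]mul1mx -vuj -[u k i]mulmx1 -vuk.
  rewrite -[_ *m v j i]mulmxA uvj [u k i *m _]mulmxA uvk.
  rewrite -mulmxA [e j i *m _]mulmxA ee ?(ltn_ord j, ltn_ord k) //.
  have /negPf-> : (j != k :> nat) by [].
  by rewrite mul0mx mulmx0.
- by move=> j i; have [-> _ _] := uvP j.
- by move=> j a; have [_ _ ->] := uvP j.
Qed.

(** The product of [g] with all [f - x *: g], over the finitely many values [x], vanishes on [C]; by
    irreducibility one factor does. *)
Lemma semi_invariants_proportional :
  (forall M, C M -> poly_eval g M = 0) \/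
  exists x, forall M, C M -> poly_eval f M = x * poly_eval g M.
Proof.
have [_ irrC _ _] := compC; have [s sP] := finitely_many_values.
have: forall M, C M -> poly_eval (g * \prod_(x <- s) (f - x *: g)) M = 0.
  move=> M CM; rewrite /poly_eval mevalM; have [->|gM] := eqVneq g.@[rep_coord M] 0.
    by rewrite mul0r.
  have xs : f.@[rep_coord M] / g.@[rep_coord M] \in s.
    by apply: sP; exists M; split; rewrite // /poly_eval mulfVK.
  rewrite (big_rem _ xs) /= mevalM mevalB mevalZ mulfVK // subrr.
  by rewrite mul0r mulr0.
elim: s {sP} => [|x s IHs] gs0.
  by left=> M CM; rewrite -(gs0 M CM) big_nil mulr1.
case: (irreducible_mul (f := f - x *: g) (g := g * \prod_(y <- s) (f - y *: g)) irrC).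
- by move=> M /gs0; rewrite big_cons mulrCA.
- move=> fx; right; exists x => M /fx /eqP.
  by rewrite /poly_eval mevalB mevalZ subr_eq0 => /eqP.
- exact: IHs.
Qed.

End FinitelyManyValues.

(** * Dependence of two semi-invariants, and the conclusion *)

Lemma dim_le1 (K : fieldType) (Q : quiver) (d : vertex Q -> nat)
    (C : rep K d -> Prop) (V : rep_poly K d -> Prop) :
    (forall f g, V f -> V g -> exists a b, (a != 0) || (b != 0) /\
      forall M, C M -> a * poly_eval f M + b * poly_eval g M = 0) ->
  dim_le C V 1.
Proof.
move=> dep F VF; have [a [b [abN0 ab0]]] := dep _ _ (VF ord0) (VF ord_max).
exists (fun k => if k == ord0 then a else b).
  by case/orP: abN0; [exists ord0 | exists ord_max].
move=> M CM; rewrite big_ord_recl big_ord1 /= /poly_eval mevalD !mevalZ.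
rewrite -[RHS](ab0 M CM); congr (_ + _ * meval _ (F _)); exact: val_inj.
Qed.

Theorem proposition9 (K : closedFieldType) (char0 : [pchar K] =i pred0)
    (Q : quiver) (I : path_alg K Q -> Prop) (admI : admissible I) :
  (schur_rep_finite I -> multiplicity_free I) /\
  (dense_orbit_property I -> multiplicity_free I).
Proof.
split=> [schurI|doI] d C compC theta; apply: dim_le1 => f g semif semig.
  case: (semi_invariants_proportional char0 schurI compC semif semig) => [g0|[x fx]].
    exists 0, 1; split; first by rewrite oner_eq0 orbT.
    by move=> M CM; rewrite mul0r add0r mul1r g0.
  exists 1, (- x); split; first by rewrite oner_eq0.
  by move=> M CM; rewrite mul1r mulNr fx // subrr.
have [M [orbC dense]] := doI d C compC.
have CM : C M.
  have [closedC _ _ _] := compC.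
  apply: (zariski_closed_ext closedC) (orbC _ (in_GL1 _ d)) => a; exact: GL_act1.
(* Both semi-invariants are multiplied by the same character along the orbit, so a relation at [M]
   holds on the orbit and, by density, on [C]. *)
have vanish a b : a * poly_eval f M + b * poly_eval g M = 0 ->
    forall N, C N -> a * poly_eval f N + b * poly_eval g N = 0.
  move=> ab0; apply: dense.
    exists (eq (a *: f + b *: g)) => N; rewrite /poly_eval.
    by split=> [abN _ <-|/(_ _ erefl)]; rewrite mevalD !mevalZ.
  move=> h hGL; rewrite (semi_invariant_GL_act semif hGL CM).
  rewrite (semi_invariant_GL_act semig hGL CM).
  by rewrite !(mulrCA _ (chi _ _)) -mulrDr ab0 mulr0.
(* The coefficients g(M) and -f(M) give a relation at [M] but may both be zero; when f(M) = 0 the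
   pair 1, 0 is used instead. *)
have [f0|fN0] := eqVneq (poly_eval f M) 0.
  exists 1, 0; split; first by rewrite oner_eq0.
  by apply: vanish; rewrite f0 mulr0 mul0r addr0.
exists (poly_eval g M), (- poly_eval f M); split; first by rewrite oppr_eq0 fN0 orbT.
by apply: vanish; rewrite mulrC mulNr subrr.
Qed.
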